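(* Let $(M,\xi)$ be a contact manifold with (local) contact form $\eta$, let $X_H$ be the contact vector field with Hamiltonian $H$, let $x_0\in M$ be an equilibrium point of $X_H$ with principal coefficient $\tau$, and let $L:T_{x_0}M\to T_{x_0}M$ be the linear part of $X_H$ at $x_0$. Then: (i) $L$ leaves $\xi(x_0)$ invariant; denote by $L_\xi$ the restriction of $L$ to $\xi(x_0)$. (ii) The linear vector field $L_\xi-\tfrac12\tau I_\xi$ on $\xi(x_0)$ is Hamiltonian with respect to the symplectic structure on $\xi(x_0)$ given by the 2-form $\mathrm{d}\eta$, where $I_\xi$ is the identity map on $\xi(x_0)$; its Hamiltonian function is given by the symmetric part of the amended Hessian, i.e. it is the quadratic form on $\xi(x_0)$ whose Hessian is the symmetric part of $\mathrm{Hess}'(H)$.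
   Context: All objects are smooth. A contact manifold $(M,\xi)$ is a manifold $M$ of dimension $2n+1$ with a rank-$2n$ subbundle $\xi\subset TM$ such that, for any (local) 1-form $\eta$ with $\ker\eta=\xi$ (a contact form), $\eta\wedge(\mathrm{d}\eta)^n$ is nowhere zero; then $\mathrm{d}\eta$ restricts to a symplectic form on each $\xi(x)$. The Reeb vector field $\mathcal{R}$ is determined by $\iota_{\mathcal{R}}\eta=1$, $\iota_{\mathcal{R}}\mathrm{d}\eta=0$. Given a function $H$, the contact vector field $X_H$ is defined by $\eta(X_H)=-H$ and $\iota_{X_H}\mathrm{d}\eta=\mathrm{d}H-\mathcal{R}(H)\eta$. At an equilibrium $x_0$ (a zero of $X_H$), $H(x_0)=0$ and $\mathrm{d}H_{x_0}=-\tau\eta_{x_0}$, where $\tau=-\mathcal{R}(H)(x_0)$ is called the principal coefficient. The amended Hessian at $x_0$ is the (in general non-symmetric) bilinear form on $\xi(x_0)$, $\mathrm{Hess}'(H)(\mathbf{u},\mathbf{v})=\mathrm{D}_{\mathbf{u}}(\mathrm{d}H+\tau\eta)(\mathbf{v})$, where $\mathrm{D}$ is the ordinary derivative with $\tau$ held constant (well defined independently of coordinates since $\mathrm{d}H+\tau\eta$ vanishes at $x_0$); in coordinates with $\eta=\sum a_i\mathrm{d}x^i$ it is $\sum_{i,j}\left(\frac{\partial^2H}{\partial x^j\partial x^i}+\tau\frac{\partial a_i}{\partial x^j}\right)u^jv^i$. Its symmetric part is $S(\mathbf{u},\mathbf{v})=\frac12(\mathrm{Hess}'(\mathbf{u},\mathbf{v})+\mathrm{Hess}'(\mathbf{v},\mathbf{u}))$.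 A linear vector field $A$ on a symplectic vector space $(V,\omega)$ is Hamiltonian with quadratic Hamiltonian function $Q(\mathbf{u})=\frac12S(\mathbf{u},\mathbf{u})$ ($S$ symmetric, the Hessian of $Q$) if $\omega(A\mathbf{u},\mathbf{v})=\mathrm{d}Q_{\mathbf{u}}(\mathbf{v})=S(\mathbf{u},\mathbf{v})$ for all $\mathbf{u},\mathbf{v}\in V$. *)

(* Defs.v *)
From HB Require Import structures.
From mathcomp Require Import all_boot all_order perm all_algebra.
From mathcomp Require Import all_classical all_reals all_analysis.
Set Implicit Arguments.
Unset Strict Implicit.
Unset Printing Implicit Defensive.
Import Order.TTheory GRing.Theory Num.Theory.
Import numFieldNormedType.Exports.
Local Open Scope classical_set_scope.
Local Open Scope ring_scope.

(* C^infinity on an open set U: every iterated directional derivative of f is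
   Frechet differentiable at every point of U. *)
Definition smooth_on (R : realType) (V W : normedModType R) (U : set V)
    (f : V -> W) : Prop :=
  forall (s : seq V) (x : V), U x ->
    differentiable (foldr (fun v (g : V -> W) => 'D_v g) f s) x.

(* [bwd] is only meaningful on the open set [fwd @` dom]. *)
Record chart (R : realType) (M : topologicalType) (d : nat) := Chart {
  dom : set M;
  fwd : M -> 'rV[R]_d;
  bwd : 'rV[R]_d -> M;
  dom_open : open dom;
  img_open : open (fwd @` dom);
  fwd_continuous : {within dom, continuous fwd};
  bwd_continuous : {within fwd @` dom, continuous bwd};
  fwdK : forall x, dom x -> bwd (fwd x) = x
}.

(* Smooth manifolds of dimension d. Besides the atlas, the structure records an
   (arbitrary) choice [chart_at x] of a chart around each point x. It serves to
   represent the tangent space T_x M as 'rV[R]_d: a row vector at x stands for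
   the tangent vector having these components in [chart_at x]. Dually, a
   covector at x is a column vector of components in [chart_at x]. *)
Record manifold (R : realType) (d : nat) := Manifold {
  point :> topologicalType;
  point_hausdorff : hausdorff_space point;
  point_second_countable : @second_countable point;
  atlas : set (chart R point d);
  chart_at : point -> chart R point d;
  chart_at_atlas : forall x, atlas (chart_at x);
  dom_chart_at : forall x, dom (chart_at x) x;
  transition_smooth : forall phi psi, atlas phi -> atlas psi ->
    smooth_on (fwd phi @` (dom phi `&` dom psi)) (fwd psi \o bwd phi)
}.

Section Manifolds.
Variables (R : realType) (d : nat) (M : manifold R d).
Implicit Types (phi psi : chart R M d) (x : M) (W : set M).

(* Jacobian at x of the change of coordinates from phi to psi; components of
   vectors transform by v |-> v *m J, those of covectors by a |-> J *m a
   (from psi to phi). *)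
Definition trans_jac phi psi x : 'M[R]_d :=
  jacobian (fwd psi \o bwd phi) (fwd phi x).

Definition coord_fun phi (f : M -> R) : 'rV[R]_d -> R := f \o bwd phi.

Definition coord_vec phi (X : M -> 'rV[R]_d) (y : 'rV[R]_d) : 'rV[R]_d :=
  let x := bwd phi y in X x *m trans_jac (chart_at x) phi x.

Definition coord_form phi (a : M -> 'cV[R]_d) (y : 'rV[R]_d) : 'cV[R]_d :=
  let x := bwd phi y in trans_jac phi (chart_at x) x *m a x.

Definition smooth_fun W (f : M -> R) : Prop :=
  forall phi, atlas phi -> smooth_on (fwd phi @` (dom phi `&` W)) (coord_fun phi f).

Definition smooth_vector_field W (X : M -> 'rV[R]_d) : Prop :=
  forall phi, atlas phi -> smooth_on (fwd phi @` (dom phi `&` W)) (coord_vec phi X).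

Definition smooth_one_form W (a : M -> 'cV[R]_d) : Prop :=
  forall phi, atlas phi -> smooth_on (fwd phi @` (dom phi `&` W)) (coord_form phi a).

Definition pairing (a : 'cV[R]_d) (v : 'rV[R]_d) : R := (v *m a) 0 0.

Definition dfun (f : M -> R) x : 'cV[R]_d :=
  \col_i 'D_(delta_mx 0 i) (coord_fun (chart_at x) f) (fwd (chart_at x) x).

(* D_u a (v) at x, for the components of a in [chart_at x]. This depends on the
   chart unless a x = 0 or one antisymmetrizes in u and v. *)
Definition deriv_form (a : M -> 'cV[R]_d) x (u v : 'rV[R]_d) : R :=
  pairing ('D_u (coord_form (chart_at x) a) (fwd (chart_at x) x)) v.

(* Normalized so that d (sum_i a_i dx^i) = sum_i da_i /\ dx^i, where
   (b /\ c)(u, v) = b(u) c(v) - b(v) c(u). *)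
Definition ext_deriv (a : M -> 'cV[R]_d) x (u v : 'rV[R]_d) : R :=
  deriv_form a x u v - deriv_form a x v u.

Definition smooth_subbundle (k : nat) (xi : M -> {vspace 'rV[R]_d}) : Prop :=
  forall x, exists (W : set M) (e : 'I_k -> M -> 'rV[R]_d),
    [/\ open W, W x, (forall i, smooth_vector_field W (e i)) &
        forall y, W y -> basis_of (xi y) [seq e i y | i <- enum 'I_k]].

(* Linear part of X at a zero x of X: the derivative of the components of X
   (at a zero, it does not depend on the chart). *)
Definition linear_part (X : M -> 'rV[R]_d) x : 'End('rV[R]_d) :=
  linfun ('d (coord_vec (chart_at x) X) (fwd (chart_at x) x)).

End Manifolds.

Section ExteriorAlgebra.
Variables (R : realType) (V : lmodType R).

Definition kform (k : nat) := ('I_k -> V) -> R.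

Definition wedge (k l : nat) (a : kform k) (b : kform l) : kform (k + l) :=
  fun v => (k`! * l`!)%:R^-1 *
    \sum_(s : 'S_(k + l)) (-1) ^+ s * a (fun i => v (s (lshift l i)))
                                    * b (fun j => v (s (rshift k j))).

Fixpoint wedge_pow (w : kform 2) (n : nat) : kform (n * 2) :=
  match n with
  | 0 => fun _ => 1
  | m.+1 => wedge w (@wedge_pow w m)
  end.

Definition kform_of_linear (a : V -> R) : kform 1 := fun v => a (v ord0).

Definition kform_of_bilinear (w : V -> V -> R) : kform 2 :=
  fun v => w (v ord0) (v ord_max).

End ExteriorAlgebra.

Section LinearHamiltonian.
Variables (R : realType) (V : vectType R).
Implicit Types (w S : V -> V -> R) (A : 'End(V)).

Definition bilinear_form w : Prop :=
  (forall u, scalar (w u)) /\ (forall v, scalar (w ^~ v)).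

Definition symplectic_form w : Prop :=
  [/\ bilinear_form w, (forall u, w u u = 0) &
      forall u, (forall v, w u v = 0) -> u = 0].

Definition quadratic_form S (u : V) : R := 2^-1 * S u u.

Definition symmetric_part (B : V -> V -> R) (u v : V) : R :=
  2^-1 * (B u v + B v u).

(* A is Hamiltonian on (V, w), with Hamiltonian function
   Q(u) = S(u, u) / 2, whose Hessian is S: w(A u, v) = dQ_u(v) = S(u, v). *)
Definition linear_hamiltonian w A S : Prop :=
  [/\ symplectic_form w, bilinear_form S, (forall u v, S u v = S v u) &
      forall u v : V,
        is_derive (0 : R) (1 : R) (fun t : R => quadratic_form S (u + t *: v))
          (w (A u) v)
        /\ w (A u) v = S u v].

(* The endomorphism of U induced by L; it is the restriction of L to U when L
   leaves U invariant. *)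
Definition restriction (L : 'End(V)) (U : {vspace V}) : 'End(subvs_of U) :=
  (linfun (vsproj U) \o L \o linfun (@vsval R V U))%VF.

End LinearHamiltonian.

Section Contact.
Variables (R : realType) (n : nat) (M : manifold R (2 * n).+1).
Notation tangent := 'rV[R]_(2 * n).+1.
Notation cotangent := 'cV[R]_(2 * n).+1.
Implicit Types (xi : M -> {vspace tangent}) (W : set M) (eta : M -> cotangent)
  (X Rb : M -> tangent) (H : M -> R).

(* A 1-form eta defined on the open set W, with kernel xi there. *)
Definition defining_form xi W eta : Prop :=
  [/\ open W, smooth_one_form W eta &
      forall x, W x -> forall v, v \in xi x <-> pairing (eta x) v = 0].

Definition contact_structure xi : Prop :=
  smooth_subbundle (2 * n) xi /\
  forall W eta, defining_form xi W eta -> forall x, W x ->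
    exists v, wedge (kform_of_linear (pairing (eta x)))
                (@wedge_pow R _ (kform_of_bilinear (ext_deriv eta x)) n) v != 0.

Definition reeb_field W eta Rb : Prop :=
  smooth_vector_field W Rb /\
  forall x, W x -> pairing (eta x) (Rb x) = 1 /\
    forall v, ext_deriv eta x (Rb x) v = 0.

Definition contact_vector_field W eta Rb H X : Prop :=
  smooth_vector_field W X /\
  forall x, W x -> pairing (eta x) (X x) = - H x /\
    forall v, ext_deriv eta x (X x) v =
      pairing (dfun H x - pairing (dfun H x) (Rb x) *: eta x) v.

Definition principal_coefficient Rb H (x0 : M) : R :=
  - pairing (dfun H x0) (Rb x0).

(* Hess'(H) as a bilinear map on T_{x0} M; tau is constant in the derivative. *)
Definition amended_hessian eta H (tau : R) (x0 : M) (u v : tangent) : R :=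
  deriv_form (fun x : M => dfun H x + tau *: eta x) x0 u v.

Definition restrict_bilinear (U : {vspace tangent}) (B : tangent -> tangent -> R)
    (u v : subvs_of U) : R := B (vsval u) (vsval v).

End Contact.

(* Main.v *)
Require Import Defs.
From HB Require Import structures.
From mathcomp Require Import all_boot all_order perm all_algebra.
From mathcomp Require Import ring lra.
From mathcomp Require Import all_classical all_reals all_analysis.
Import Order.TTheory GRing.Theory Num.Theory.
Import numFieldNormedType.Exports.
Set Implicit Arguments.
Unset Strict Implicit.
Unset Printing Implicit Defensive.
Local Open Scope classical_set_scope.
Local Open Scope ring_scope.

(* Both equations defining X_H are transported to the single chart chosen at
   x0 and differentiated there; for [iota_X d eta = dH - R(H) eta] this needs
   the naturality of the exterior derivative, i.e. the symmetry of second
   derivatives. As X_H vanishes at x0, differentiating [eta(X_H) = -H] gives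
   [eta(L u) = tau eta(u)], whence the invariance of xi, and differentiating
   the other equation gives [d eta(L u, v) = Hess'(u, v)] for v in xi. The
   antisymmetric part of Hess' is [tau/2 d eta], so subtracting [tau/2] from L
   leaves the symmetric part. A vector of xi orthogonal to xi for [d eta] is
   orthogonal to everything, since the Reeb field is; it then annihilates the
   form [eta /\ (d eta)^n], hence is zero. *)

(** * Alternating multilinear forms and the radical of a contact form *)

Section AlternatingForms.
Variables (R : realType) (V : lmodType R).

Definition with_slot k (v : 'I_k -> V) (j : 'I_k) (x : V) : 'I_k -> V :=
  fun i => if i == j then x else v i.

Definition multilinear k (f : kform V k) : Prop :=
  forall v j, scalar (fun x => f (with_slot v j x)).

Definition alternating k (f : kform V k) : Prop :=
  forall v i j, i != j -> v i = v j -> f v = 0.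

(** Substituting [s * t] for [s] in the sum over permutations absorbs the permutation of the
    arguments and leaves the sign of [t]. *)
Lemma wedge_perm k l (a : kform V k) (b : kform V l) (v : 'I_(k + l) -> V)
    (t : 'S_(k + l)) :
  wedge a b (fun i => v (t i)) = (-1) ^+ t * wedge a b v.
Proof.
rewrite /wedge mulrCA; congr (_ * _).
rewrite [in RHS](reindex_inj (mulIg t)) /= mulr_sumr; apply: eq_bigr => s _.
rewrite !mulrA odd_permM addbC signr_addb !mulrA -signr_addb addbb mul1r.
by congr (_ * a _ * b _); apply/funext => i; rewrite permM.
Qed.

(** The transposition of two equal arguments fixes [v] and changes the sign, so the value is its own
    opposite. *)
Lemma wedge_alternating k l (a : kform V k) (b : kform V l) :
  alternating (wedge a b).
Proof.
move=> v i j ij vij; have := wedge_perm a b v (tperm i j).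
rewrite odd_tperm ij expr1 mulN1r.
have -> : (fun r => v (tperm i j r)) = v.
  by apply/funext => r; case: tpermP => // ->.
by move/eqP; rewrite -addr_eq0 -mulr2n mulrn_eq0 => /eqP.
Qed.

Lemma with_slot_perm_lshift k l (v : 'I_(k + l) -> V) (s : 'S_(k + l)) i x :
  (fun r => with_slot v (s (lshift l i)) x (s (lshift l r))) =
  with_slot (fun r => v (s (lshift l r))) i x.
Proof.
by apply/funext => r; rewrite /with_slot (inj_eq perm_inj) (inj_eq (@lshift_inj _ _)).
Qed.

Lemma with_slot_perm_rshift k l (v : 'I_(k + l) -> V) (s : 'S_(k + l)) i x :
  (fun r => with_slot v (s (rshift k i)) x (s (rshift k r))) =
  with_slot (fun r => v (s (rshift k r))) i x.
Proof.
by apply/funext => r; rewrite /with_slot (inj_eq perm_inj) (inj_eq (@rshift_inj _ _)).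
Qed.

Lemma wedge_multilinear k l (a : kform V k) (b : kform V l) :
  multilinear a -> multilinear b -> multilinear (wedge a b).
Proof.
move=> am bm v j c x y; rewrite /wedge [in RHS]mulrCA -mulrDr; congr (_ * _).
rewrite mulr_sumr -big_split /=; apply: eq_bigr => s _.
(* The slot [j] is the image under [s] of exactly one position. If that position belongs to [a], the
   factor [b] does not see the slot, and conversely. *)
rewrite -[j](permKV s); case: (split_ordP ((s^-1)%g j)) => i ->.
- rewrite !with_slot_perm_lshift (am _ i) /=.
  have e z : (fun r => with_slot v (s (lshift l i)) z (s (rshift k r))) =
             (fun r => v (s (rshift k r))).
    by apply/funext => r; rewrite /with_slot (inj_eq perm_inj) eq_rlshift.
  by rewrite !e mulrDr mulrDl !mulrA; congr (_ * _ * _ + _); rewrite mulrC.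
- rewrite !with_slot_perm_rshift (bm _ i) /=.
  have e z : (fun r => with_slot v (s (rshift k i)) z (s (lshift l r))) =
             (fun r => v (s (lshift l r))).
    by apply/funext => r; rewrite /with_slot (inj_eq perm_inj) eq_lrshift.
  by rewrite !e mulrDr; congr (_ + _); rewrite mulrCA.
Qed.

Lemma kform_of_linear_multilinear (a : V -> R) :
  scalar a -> multilinear (kform_of_linear a).
Proof.
move=> al v j c x y; rewrite /kform_of_linear /with_slot.
have -> : ord0 == j by rewrite (ord1 j).
exact: al.
Qed.

Lemma kform_of_bilinear_multilinear (w : V -> V -> R) :
  (forall u, scalar (w u)) -> (forall v, scalar (w ^~ v)) ->
  multilinear (kform_of_bilinear w).
Proof.
move=> wl wr v j c x y; rewrite /kform_of_bilinear /with_slot.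
have [<-|j0] := eqVneq ord0 j; first by rewrite /= wr.
have -> : ord_max == j by apply/eqP/val_inj; move: j j0 => [[|[|]]].
exact: wl.
Qed.

Lemma wedge_pow_multilinear (w : kform V 2) n :
  multilinear w -> multilinear (@wedge_pow R V w n).
Proof.
move=> wm; elim: n => [v [] //|n IH] /=.
exact: (wedge_multilinear wm IH).
Qed.

Lemma wedge_pow_comp (w : kform V 2) (P : V -> V) n (v : 'I_(n * 2) -> V) :
  (forall u, w (fun i => P (u i)) = w u) ->
  @wedge_pow R V w n (fun i => P (v i)) = @wedge_pow R V w n v.
Proof.
move=> wP; elim: n v => [//|n IH] v /=.
rewrite /wedge; congr (_ * _); apply: eq_bigr => s _.
by rewrite (IH (fun j => v (s (rshift 2 j)))) (wP (fun j => v (s (lshift _ j)))).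
Qed.

(** Put the relation itself into slot [j]: the value is 0, and in the expansion every term but
    [c j * f v] repeats an argument. *)
Lemma alternating_dependent k (f : kform V k) (v : 'I_k -> V) (c : 'I_k -> R) j :
  multilinear f -> alternating f -> c j != 0 -> \sum_i c i *: v i = 0 ->
  f v = 0.
Proof.
move=> fm fa cj sum0.
have vE : with_slot v j (v j) = v.
  by apply/funext => i; rewrite /with_slot; case: eqP => // ->.
(* Linearity with coefficient -1 at two zero vectors reads f(0) = - f(0) + f(0). *)
have f0 : f (with_slot v j 0) = 0.
  by have := fm v j (-1) 0 0; rewrite scaler0 addr0 mulN1r addNr.
have fs (s : seq 'I_k) : f (with_slot v j (\sum_(i <- s) c i *: v i)) =
    \sum_(i <- s) c i * f (with_slot v j (v i)).
  by elim: s => [|i s IH]; rewrite ?big_nil // !big_cons (fm v j) /= IH.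
have := fs (index_enum 'I_k); rewrite sum0 f0 (bigD1 j) //= big1 ?addr0.
  by move/esym/eqP; rewrite vE mulf_eq0 (negPf cj) => /eqP.
move=> i ij; rewrite (fa _ i j) ?mulr0 //.
by rewrite /with_slot eqxx (negPf ij).
Qed.

End AlternatingForms.

(* The projection killing [u] preserves [a] and [w], so the top form only sees
   a space of smaller dimension. *)
Lemma contact_form_radical (R : realType) (n : nat)
    (a : 'rV[R]_(2 * n).+1 -> R) (w : 'rV[R]_(2 * n).+1 -> 'rV[R]_(2 * n).+1 -> R)
    (v : 'I_(1 + n * 2) -> 'rV[R]_(2 * n).+1) (u : 'rV[R]_(2 * n).+1) :
  scalar a -> bilinear_form w -> (forall x, w x x = 0) ->
  a u = 0 -> (forall x, w u x = 0) ->
  wedge (kform_of_linear a) (@wedge_pow R _ (kform_of_bilinear w) n) v != 0 ->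
  u = 0.
Proof.
move=> al wb walt au wu; apply: contraNeq => /rV0Pn [k uk].
have [wl wr] := wb.
have wZDl c x y z : w (c *: x + y) z = c * w x z + w y z by exact: wr.
have wZDr c x y z : w z (c *: x + y) = c * w z x + w z y by exact: wl.
have wu' x : w x u = 0.
  have := walt (1 *: u + x).
  by rewrite wZDl !wZDr !walt !wu !mul1r !add0r addr0.
(* The coefficient is chosen so that the [k]-th coordinate of [P x] vanishes. *)
pose P (x : 'rV[R]_(2 * n).+1) := (- (x 0 k / u 0 k)) *: u + x.
have aP x : a (P x) = a x by rewrite /P al au mulr0 add0r.
have wP x y : w (P x) (P y) = w x y.
  by rewrite /P wZDl !wZDr wu wu' wu !mulr0 !add0r mulr0 add0r.
have wPv : wedge (kform_of_linear a) (@wedge_pow R _ (kform_of_bilinear w) n)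
    (fun i => P (v i)) =
  wedge (kform_of_linear a) (@wedge_pow R _ (kform_of_bilinear w) n) v.
  rewrite /wedge; congr (_ * _); apply: eq_bigr => s _.
  rewrite {1}/kform_of_linear aP; congr (_ * _).
  apply: (wedge_pow_comp (fun j => v (s (rshift 1 j)))) => z.
  exact: wP.
rewrite -wPv.
(* The rows of this square matrix are the vectors [P (v i)]. Its [k]-th column is zero, so it is
   singular, and a nonzero row of its left kernel is a linear relation between them. *)
pose A : 'M[R]_(1 + n * 2, (2 * n).+1) := \matrix_(i, j) P (v i) 0 j.
have Ak : A *m delta_mx k (0 : 'I_1) = 0.
  apply/matrixP => i j; rewrite ord1 mxE (bigD1 k) //= big1.
    by rewrite !mxE !eqxx mulr1 addr0 mulNr divfK // addNr.
  by move=> l lk; rewrite !mxE (negPf lk) mulr0.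
have rA : ~~ row_free A.
  apply/negP => /eqP rkA.
  have /row_fullP [B BA] : row_full A by rewrite /row_full rkA add1n mulnC.
  have : (delta_mx k 0 : 'cV[R]_(2 * n).+1) k 0 = 0.
    by rewrite -[delta_mx k 0]mul1mx -BA -mulmxA Ak mulmx0 mxE.
  by rewrite mxE !eqxx => /eqP; rewrite oner_eq0.
have /rV0Pn [j cj] : nz_row (kermx A) != 0 by rewrite nz_row_eq0 kermx_eq0.
apply/eqP/(alternating_dependent (c := fun i => nz_row (kermx A) 0 i) (j := j)) => //.
- apply: wedge_multilinear; first exact: kform_of_linear_multilinear.
  exact/wedge_pow_multilinear/kform_of_bilinear_multilinear.
- exact: wedge_alternating.
have /sub_kermxP cA : (nz_row (kermx A) <= kermx A)%MS by exact: nz_row_sub.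
apply/rowP => l; rewrite summxE -[RHS](congr1 (fun m : 'rV_ _ => m 0 l) cA) mxE.
by apply: eq_bigr => i _; rewrite !mxE.
Qed.

(** * Symmetry of second directional derivatives *)

Section Schwarz.
Variables (R : realType) (V : normedModType R).

Lemma differentiable_remainder (W : normedModType R) (f : V -> W) x (e : R) :
  0 < e -> differentiable f x ->
  \forall h \near 0, `|f (h + x) - f x - 'd f x h| <= e * `|h|.
Proof.
move=> e0 fx; have [_ /eqaddoP/(_ e e0)] := (diff_locallyP x f).1 fx.
by apply: filterS => h /=; rewrite -addrA -opprD.
Qed.

Lemma derive_line (f : V -> R) (u c : V) (s : R) :
  'D_1 (fun r : R => f (r *: u + c)) s = 'D_u f (s *: u + c).
Proof.
rewrite /derive; set g := (X in X @ _); set h := (X in _ = lim (X @ _)).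
suff -> : g = h by [].
by apply/funext => r; rewrite /g /h /= [r *: 1]mulr1 scalerDl addrA.
Qed.

Lemma is_derive_line (f : V -> R) (u c : V) (s : R) :
  differentiable f (s *: u + c) ->
  is_derive s (1 : R) (fun r : R => f (r *: u + c)) ('D_u f (s *: u + c)).
Proof.
move=> df; rewrite -derive_line; apply: derivableP.
have := @diff_derivable _ _ _ f _ u df; rewrite /derivable.
set g := (X in X @ _); set h := (X in _ -> cvg (X @ _)).
suff -> : g = h by [].
by apply/funext => r; rewrite /g /h /= [r *: 1]mulr1 scalerDl addrA.
Qed.

Definition second_difference (f : V -> R) (x u v : V) (t : R) : R :=
  f (t *: u + (t *: v + x)) - f (t *: u + x) - (f (t *: v + x) - f x).

Lemma second_differenceC (f : V -> R) (x u v : V) (t : R) :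
  second_difference f x u v t = second_difference f x v u t.
Proof. by rewrite /second_difference addrCA; ring. Qed.

(** The mean value theorem along [u] turns the second difference into [t] times an increment of
    ['D_u f] between points close to [x]. Differentiability of ['D_u f] at [x] then bounds the
    error; continuity of second derivatives is not assumed. *)
Lemma second_difference_approx (f : V -> R) (x u v : V) (e : R) :
  0 < e -> (\forall y \near x, differentiable f y) ->
  differentiable ('D_u f) x ->
  \forall t \near 0^'+,
    `|second_difference f x u v t / t ^+ 2 - 'D_v ('D_u f) x| <=
      e * (`|u| *+ 2 + `|v|).
Proof.
move=> e0 fx gx; set g := 'D_u f.
have near0 : \forall h \near (0 : V), differentiable f (h + x) /\
    `|g (h + x) - g x - 'd g x h| <= e * `|h|.
  apply: filterI; last exact: differentiable_remainder.
  by move: fx; rewrite (near_shift 0) subr0.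
have [d /= d0 {}near0] := (nbhs_ballP _ _).1 near0.
have hd h : `|h| < d -> differentiable f (h + x) /\
    `|g (h + x) - g x - 'd g x h| <= e * `|h|.
  by move=> hd; apply: near0; rewrite -ball_normE /= sub0r normrN.
near=> t.
have t0 : 0 < t by near: t; exact: nbhs_right_gt.
(* All points [a *: u + b *: v] with a, b in [0, t] then have norm below [d]. The added 1 keeps the
   divisor positive when [u] and [v] are zero. *)
have td : t * (`|u| + `|v| + 1) < d.
  rewrite -ltr_pdivlMr ?ltr_wpDl ?addr_ge0 //; near: t; apply: nbhs_right_lt.
  by rewrite divr_gt0 // ltr_wpDl ?addr_ge0.
have small (a b : R) : 0 <= a <= t -> 0 <= b <= t ->
    `|a *: u + b *: v| <= a * `|u| + b * `|v| /\ `|a *: u + b *: v| < d.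
  move=> /andP[a0 at_] /andP[b0 bt].
  have le1 : `|a *: u + b *: v| <= a * `|u| + b * `|v|.
    by rewrite (le_trans (ler_normD _ _)) // !normrZ !ger0_norm.
  split => //; apply: le_lt_trans le1 _; apply: le_lt_trans td.
  have := ler_wpM2r (normr_ge0 u) at_; have := ler_wpM2r (normr_ge0 v) bt.
  lra.
(* The increment of [f] along [t *: v], seen as a function of the position along [u]; its variation
   over [0, t] is the second difference. *)
pose phi (s : R) := f (s *: u + (t *: v + x)) - f (s *: u + x).
pose dphi (s : R) := g (s *: u + (t *: v + x)) - g (s *: u + x).
have tt : 0 <= t <= t by rewrite (ltW t0) lexx.
have t00 : 0 <= (0 : R) <= t by rewrite (ltW t0) lexx.
have phiD s : 0 <= s <= t -> is_derive s (1 : R) phi (dphi s).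
  move=> st; apply: is_deriveB; apply: is_derive_line.
    by rewrite addrA; exact: (hd _ (small _ _ st tt).2).1.
  by have := small _ _ st t00; rewrite scale0r addr0 => -[_] /hd [].
have [c /[!in_itv]/= /andP[c0 ct]] : exists2 c, c \in `]0, t[%R &
    phi t - phi 0 = dphi c * (t - 0).
  apply: MVT => //.
    by move=> s /[!in_itv] /= /andP[s0 st]; apply: phiD; rewrite !ltW.
  apply: derivable_within_continuous => s /[!in_itv] /= st.
  by have [] := phiD s st.
rewrite subr0 => phiE.
have -> : second_difference f x u v t = dphi c * t.
  by rewrite -phiE /phi /second_difference !scale0r !add0r.
have ctt : 0 <= c <= t by rewrite !ltW.
have [n1 /hd [_ e1]] := small _ _ ctt tt.
have := small _ _ ctt t00; rewrite scale0r addr0 mul0r addr0.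
move=> [n2 /hd [_ e2]].
have -> : 'D_v g x = 'd g x v by rewrite deriveE.
(* Both values of [g] are compared with the affine approximation at [x]. The linear terms in
   [c *: u] cancel, and only two first-order remainders are left. *)
have -> : dphi c * t / t ^+ 2 - 'd g x v =
   t^-1 * ((g (c *: u + t *: v + x) - g x - 'd g x (c *: u + t *: v)) -
     (g (c *: u + x) - g x - 'd g x (c *: u))).
  rewrite /dphi linearD (linearZ _ v) /= /GRing.scale /= addrA.
  by field; rewrite gt_eqF.
rewrite normrM gtr0_norm ?invr_gt0 // ler_pdivrMl //.
apply: le_trans (ler_normB _ _) _; apply: le_trans (lerD e1 e2) _.
rewrite -mulrDr mulrCA ler_pM2l //; apply: le_trans (lerD n1 n2) _.
have := ler_wpM2r (normr_ge0 u) (ltW ct); lra.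
Unshelve. all: by end_near. Qed.

(** The same quotient, symmetric in [u] and [v], approximates both mixed derivatives. *)
Lemma derive_derive_comm_real (f : V -> R) (x u v : V) :
  (\forall y \near x, differentiable f y) ->
  differentiable ('D_u f) x -> differentiable ('D_v f) x ->
  'D_u ('D_v f) x = 'D_v ('D_u f) x.
Proof.
move=> fx ux vx; apply/eqP; rewrite -subr_eq0 -normr_le0; apply/ler_addgt0Pl => e e0.
rewrite addr0.
(* The sum of the two error constants, plus 1 so that it can be divided by. *)
pose K := (`|u| *+ 2 + `|v|) + (`|v| *+ 2 + `|u|) + 1.
have K0 : 0 < K by rewrite ltr_wpDl // !addr_ge0 // mulrn_wge0.
have eK : 0 < e / K by rewrite divr_gt0.
near (0:R)^'+ => t.
have h1 : `|second_difference f x u v t / t ^+ 2 - 'D_v ('D_u f) x| <=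
    e / K * (`|u| *+ 2 + `|v|).
  by near: t; exact: second_difference_approx.
have h2 : `|second_difference f x v u t / t ^+ 2 - 'D_u ('D_v f) x| <=
    e / K * (`|v| *+ 2 + `|u|).
  by near: t; exact: second_difference_approx.
rewrite -(second_differenceC _ _ u v) in h2.
set q := _ / _ in h1 h2.
have -> : 'D_u ('D_v f) x - 'D_v ('D_u f) x =
   (q - 'D_v ('D_u f) x) - (q - 'D_u ('D_v f) x) by ring.
apply: le_trans (ler_normB _ _) _; apply: le_trans (lerD h1 h2) _.
rewrite -mulrDr -mulrA -[leRHS]mulr1 ler_pM2l // ler_pdivrMl // mulr1.
by rewrite /K lerDl.
Unshelve. all: by end_near. Qed.

End Schwarz.

(** * Rules for directional derivatives *)

Section Derivatives.
Variables (R : realType) (V : normedModType R).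

(** Both maps have the same first-order expansion at [x], and uniqueness of the differential does
    the rest. *)
Lemma near_eq_differentiable (W : normedModType R) (f g : V -> W) x :
  (\forall y \near x, f y = g y) -> differentiable f x -> differentiable g x.
Proof.
move=> fg fx; have fgx := nbhs_singleton fg.
have [fc /eqaddoP fE] := (diff_locallyP x f).1 fx.
have gE : g \o shift x = cst (g x) + 'd f x +o_ (0 : V) id.
  apply/eqaddoP => e e0; have := fE e e0.
  have : \forall y \near (0 : V), f (y + x) = g (y + x).
    by move: fg; rewrite (near_shift 0) subr0.
  by apply: filterS2 => y /= fgy; rewrite !fctE /= fgx fgy.
have dE := diff_unique fc gE.
by apply/diff_locallyP; rewrite dE.
Qed.

Lemma derivable_comp (U W : normedModType R) (f : V -> U) (g : U -> W) x u :
  differentiable f x -> differentiable g (f x) ->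
  is_derive x u (g \o f) ('D_('D_u f x) g (f x)).
Proof.
move=> fx gx; have gfx := differentiable_comp fx gx.
apply: DeriveDef; first exact: diff_derivable.
by rewrite !deriveE // diff_comp.
Qed.

Lemma derive_linear_dir (W : normedModType R) (f : V -> W) x c u v :
  differentiable f x -> 'D_(c *: u + v) f x = c *: 'D_u f x + 'D_v f x.
Proof. by move=> fx; rewrite !deriveE // linearP. Qed.

Lemma is_derive_coord m n (f : V -> 'M[R]_(m, n)) x u i j :
  derivable f x u -> is_derive x u (fun y => f y i j) ('D_u f x i j).
Proof.
move=> fx; apply: DeriveDef; first by have /derivable_mxP := fx; exact.
by rewrite derive_mx // mxE.
Qed.

Lemma differentiable_entry m n (f : V -> 'M[R]_(m, n)) x i j :
  differentiable f x -> differentiable (fun y => f y i j) x.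
Proof.
move=> fx.
exact: (@differentiable_comp R V 'M[R]_(m, n) R f (fun N => N i j) x fx
  (differentiable_coord (f x) i j)).
Qed.

Lemma derive_derive_comm m n (f : V -> 'M[R]_(m, n)) x u v :
  (\forall y \near x, differentiable f y) ->
  (forall w, differentiable ('D_w f) x) ->
  'D_u ('D_v f) x = 'D_v ('D_u f) x.
Proof.
move=> fx dfx; apply/matrixP => i j.
have e w : \forall y \near x, 'D_w f y i j = 'D_w (fun z => f z i j) y.
  apply: filterS fx => y fy.
  by have [_ ->] := is_derive_coord i j (diff_derivable (v := w) fy).
have dij w : differentiable ('D_w (fun z => f z i j)) x.
  by apply: near_eq_differentiable (e w) _; exact: differentiable_entry.
have h w w' : 'D_w ('D_w' f) x i j = 'D_w ('D_w' (fun z => f z i j)) x.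
  rewrite -(near_eq_derive _ (e w')).
  by have [_ ->] := is_derive_coord i j (diff_derivable (v := w) (dfx w')).
have fij : \forall y \near x, differentiable (fun z => f z i j) y.
  by apply: filterS fx => y fy; exact: differentiable_entry.
apply: etrans (h u v) _; apply: etrans _ (esym (h v u)).
exact: (derive_derive_comm_real fij (dij u) (dij v)).
Qed.

End Derivatives.

(** * The pairing of covectors with vectors and its derivative *)

Section Pairing.
Variables (R : realType) (d : nat).
Implicit Types (a : 'cV[R]_d) (v : 'rV[R]_d).

Lemma pairing_sum a v : pairing a v = \sum_k v 0 k * a k 0.
Proof. by rewrite /pairing mxE. Qed.

Lemma pairing_linear a c u v : pairing a (c *: u + v) = c * pairing a u + pairing a v.
Proof. by rewrite /pairing mulmxDl -scalemxAl !mxE. Qed.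

Lemma pairingDl a b v : pairing (a + b) v = pairing a v + pairing b v.
Proof. by rewrite /pairing mulmxDr mxE. Qed.

Lemma pairingZl c a v : pairing (c *: a) v = c * pairing a v.
Proof. by rewrite /pairing -scalemxAr mxE. Qed.

Lemma pairing0r a : pairing a 0 = 0.
Proof. by rewrite /pairing mul0mx mxE. Qed.

Lemma pairing_mulmx (J : 'M[R]_d) a v : pairing (J *m a) v = pairing a (v *m J).
Proof. by rewrite /pairing mulmxA. Qed.

Lemma is_derive_pairing (V : normedModType R) (f : V -> 'cV[R]_d)
    (g : V -> 'rV[R]_d) x u :
  derivable f x u -> derivable g x u ->
  is_derive x u (fun y => pairing (f y) (g y))
    (pairing ('D_u f x) (g x) + pairing (f x) ('D_u g x)).
Proof.
move=> fx gx.
have -> : (fun y => pairing (f y) (g y)) =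
    \sum_(k < d) ((fun y => g y 0 k) * (fun y => f y k 0)).
  by apply/funext => y; rewrite pairing_sum fct_sumE.
rewrite !pairing_sum -big_split /=; apply: is_derive_sum => k.
apply: (is_derive_eq (is_deriveM (is_derive_coord _ _ gx) (is_derive_coord _ _ fx))).
by rewrite /GRing.scale /= [X in _ + X]mulrC.
Qed.

Lemma derive_pairing (V : normedModType R) (f : V -> 'cV[R]_d) v x u :
  derivable f x u -> is_derive x u (fun y => pairing (f y) v) (pairing ('D_u f x) v).
Proof.
move=> fx; apply: (is_derive_eq (is_derive_pairing fx (derivable_cst v x u))).
by rewrite derive_cst pairing0r addr0.
Qed.

Lemma derive_gradient (h : 'rV[R]_d -> R) y w : differentiable h y ->
  'D_w h y = pairing (\col_i 'D_(delta_mx 0 i) h y) w.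
Proof.
move=> hy; rewrite pairing_sum.
apply: etrans (deriveE _ hy) _; rewrite [w in LHS]row_sum_delta linear_sum /=.
apply: eq_bigr => k _; rewrite linearZ; congr (_ * _).
by rewrite [RHS]mxE; exact: esym (deriveE _ hy).
Qed.

End Pairing.

(** * The exterior derivative in coordinates and its naturality *)

Section CoordinateForms.
Variables (R : realType) (d : nat).
Implicit Types (a b : 'rV[R]_d -> 'cV[R]_d) (y u v : 'rV[R]_d).

(** In contrast with [ext_deriv], which uses the preferred chart of each point, this is computed in
    one fixed coordinate system, so it can be differentiated in [y]. *)
Definition coord_ext_deriv a y u v : R :=
  pairing ('D_u a y) v - pairing ('D_v a y) u.

Lemma coord_ext_derivC a y u v : coord_ext_deriv a y u v = - coord_ext_deriv a y v u.
Proof. by rewrite /coord_ext_deriv opprB. Qed.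

Lemma coord_ext_deriv_linear a y v c z w : differentiable a y ->
  coord_ext_deriv a y (c *: z + w) v =
    c * coord_ext_deriv a y z v + coord_ext_deriv a y w v.
Proof.
move=> ay; rewrite /coord_ext_deriv (derive_linear_dir c z w ay).
move: ('D_v a y) ('D_z a y) ('D_w a y) => p q r.
by rewrite pairingDl pairingZl pairing_linear mulrBr opprD addrACA.
Qed.

Lemma coord_ext_deriv_bilinear a y :
  differentiable a y -> bilinear_form (coord_ext_deriv a y).
Proof.
move=> ay; split => [u|v] c z w; last exact: coord_ext_deriv_linear.
rewrite !(coord_ext_derivC a y u) (coord_ext_deriv_linear u c z w ay).
by rewrite opprD mulrN.
Qed.

(** This is d(T^* b) = T^*(db); the last hypothesis says that [a] is the pullback of [b] near [y].
    Differentiating it produces a term in the second derivative of [T], which antisymmetrization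
    cancels by symmetry. *)
Lemma coord_ext_deriv_pullback (T : 'rV[R]_d -> 'rV[R]_d) a b y u v :
  (\forall z \near y, differentiable T z) ->
  (forall w, differentiable ('D_w T) y) ->
  differentiable a y -> differentiable b (T y) ->
  (forall w, \forall z \near y, pairing (a z) w = pairing (b (T z)) ('D_w T z)) ->
  coord_ext_deriv a y u v = coord_ext_deriv b (T y) ('D_u T y) ('D_v T y).
Proof.
move=> Ty dTy ay bTy aE; have Tyy := nbhs_singleton Ty.
have step w w' : pairing ('D_w a y) w' =
    pairing ('D_('D_w T y) b (T y)) ('D_w' T y) + pairing (b (T y)) ('D_w ('D_w' T) y).
  have [_ <-] := derive_pairing w' (diff_derivable (v := w) ay).
  rewrite (near_eq_derive _ (aE w')).
  have [bD bE] := derivable_comp w Tyy bTy.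
  by have [_ ->] := is_derive_pairing bD (diff_derivable (v := w) (dTy w')); rewrite bE.
apply: etrans (congr2 (fun r s => r - s) (step u v) (step v u)) _.
move: ('D_u ('D_v T) y) ('D_v ('D_u T) y) (derive_derive_comm u v Ty dTy) => p _ <-.
have alg (r s t : R) : r + t - (s + t) = r - s by ring.
exact: alg.
Qed.

End CoordinateForms.

(** * Differentiating the contact equations at a zero of the field *)

Section Linearization.
Variables (R : realType) (d : nat) (a : 'rV[R]_d -> 'cV[R]_d)
  (Y : 'rV[R]_d -> 'rV[R]_d) (h rho : 'rV[R]_d -> R) (y0 : 'rV[R]_d).
Hypothesis a_diff : \forall y \near y0, differentiable a y.
Hypothesis Da_diff : forall w, differentiable ('D_w a) y0.
Hypothesis Y_diff : differentiable Y y0.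
Hypothesis Y0 : Y y0 = 0.

(** In the product rule the term containing the derivative of [a] is paired with [Y y0], which is
    0. *)
Lemma linearized_pairing u :
  (\forall y \near y0, pairing (a y) (Y y) = - h y) ->
  differentiable h y0 ->
  pairing (a y0) ('D_u Y y0) = - 'D_u h y0.
Proof.
move=> aY hy.
have [_] := is_derive_pairing (diff_derivable (v := u) (nbhs_singleton a_diff))
  (diff_derivable (v := u) Y_diff).
rewrite Y0 pairing0r add0r => <-; rewrite (near_eq_derive _ aY).
by rewrite deriveN //; exact: diff_derivable.
Qed.

(** Here [rho] stands for R(H). Its derivative drops out because it is multiplied by the value of
    the form on [v], and derivatives of the coefficients of the 2-form drop out because [Y]
    vanishes. *)
Lemma linearized_ext_deriv u v :
  (\forall y \near y0, coord_ext_deriv a y (Y y) v =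
     'D_v h y - rho y * pairing (a y) v) ->
  differentiable ('D_v h) y0 -> derivable rho y0 u ->
  pairing (a y0) v = 0 ->
  coord_ext_deriv a y0 ('D_u Y y0) v =
    'D_u ('D_v h) y0 - rho y0 * pairing ('D_u a y0) v.
Proof.
move=> extE hv rhoD av0; have ay0 := nbhs_singleton a_diff.
(* With [v] frozen, the 2-form becomes a covector field paired with [Y], to which the product rule
   applies. *)
pose c y : 'cV[R]_d := \col_i coord_ext_deriv a y (delta_mx 0 i) v.
have cE y : differentiable a y -> forall w, coord_ext_deriv a y w v = pairing (c y) w.
  move=> /coord_ext_deriv_bilinear [_ /(_ v) lin] w.
  pose f : {scalar 'rV[R]_d} := HB.pack (coord_ext_deriv a y ^~ v)
    (GRing.isLinear.Build _ _ _ _ _ lin).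
  rewrite pairing_sum [X in coord_ext_deriv a y X v](row_sum_delta w).
  have := linear_sum f; rewrite /f /= => ->.
  by apply: eq_bigr => k _; have := scalarZ f (w 0 k); rewrite /f /= => ->; rewrite mxE.
have cD : derivable c y0 u.
  apply/derivable_mxP => i j; under eq_fun do rewrite mxE.
  apply: derivableB.
    by have [] := derive_pairing v (diff_derivable (v := u) (Da_diff (delta_mx 0 i))).
  by have [] := derive_pairing (delta_mx 0 i) (diff_derivable (v := u) (Da_diff v)).
have [_] := is_derive_pairing cD (diff_derivable (v := u) Y_diff).
rewrite Y0 pairing0r add0r -cE // => <-.
have e : \forall y \near y0, pairing (c y) (Y y) = 'D_v h y - rho y * pairing (a y) v.
  by apply: filterS2 a_diff extE => y ay <-; rewrite cE.
rewrite (near_eq_derive _ e).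
have rD := is_deriveM (derivableP rhoD) (derive_pairing v (diff_derivable (v := u) ay0)).
have [_] := is_deriveB (derivableP (diff_derivable (v := u) hv)) rD.
by rewrite av0 scale0r addr0.
Qed.

End Linearization.

(** * Smooth maps, charts and changes of coordinates *)

Section Smooth.
Variables (R : realType) (V W : normedModType R) (U : set V) (f : V -> W).
Hypothesis f_smooth : smooth_on U f.

Lemma smooth_on_differentiable x : U x -> differentiable f x.
Proof. exact: (f_smooth [::]). Qed.

Lemma smooth_on_derive_differentiable v x : U x -> differentiable ('D_v f) x.
Proof. exact: (f_smooth [:: v]). Qed.

End Smooth.

Section Charts.
Variables (R : realType) (d : nat) (M : manifold R d).
Implicit Types (phi psi chi : chart R M d) (x : M) (W : set M).

(** Lets an identity between points of the manifold be read as an identity near a coordinate point,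
    where it can be differentiated. It rests on the openness of the chart image and the continuity
    of [bwd]. *)
Lemma near_chart phi W x : open W -> dom phi x -> W x ->
  \forall y \near fwd phi x, exists2 x', dom phi x' /\ W x' & y = fwd phi x'.
Proof.
move=> oW px Wx.
have ix : (fwd phi @` dom phi) (fwd phi x) by exists x.
have bc : {for fwd phi x, continuous (bwd phi)}.
  have := @bwd_continuous _ _ _ phi; rewrite continuous_open_subspace; last exact: img_open.
  by apply; rewrite inE.
have nW : \forall y \near fwd phi x, W (bwd phi y).
  by apply: bc; apply: open_nbhs_nbhs; split => //; rewrite fwdK.
have nI : \forall y \near fwd phi x, (fwd phi @` dom phi) y.
  by apply: open_nbhs_nbhs; split => //; exact: img_open.
apply: filterS2 nW nI => y Wy [x' px' yE]; exists x' => //.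
by move: Wy; rewrite -yE fwdK.
Qed.

Lemma near_chartP phi W x (P : 'rV[R]_d -> Prop) : open W -> dom phi x -> W x ->
  (forall x', dom phi x' -> W x' -> P (fwd phi x')) ->
  \forall y \near fwd phi x, P y.
Proof.
move=> oW px Wx WP; apply: filterS (near_chart oW px Wx) => y [x' [px' Wx'] ->].
exact: WP.
Qed.

Definition transition phi psi : 'rV[R]_d -> 'rV[R]_d := fwd psi \o bwd phi.

Lemma transition_fwd phi psi x : dom phi x -> transition phi psi (fwd phi x) = fwd psi x.
Proof. by move=> px; rewrite /transition /= fwdK. Qed.

Lemma transition_differentiable phi psi x : atlas phi -> atlas psi ->
  dom phi x -> dom psi x -> differentiable (transition phi psi) (fwd phi x).
Proof.
move=> aphi apsi px qx; apply: (smooth_on_differentiable (transition_smooth aphi apsi)).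
by exists x.
Qed.

Lemma derive_transition phi psi x v : atlas phi -> atlas psi ->
  dom phi x -> dom psi x ->
  'D_v (transition phi psi) (fwd phi x) = v *m trans_jac phi psi x.
Proof.
by move=> *; rewrite deriveEjacobian //; exact: transition_differentiable.
Qed.

(** The chain rule for a factorization of the transition map that holds near the point, on the
    domain of [psi]. *)
Lemma trans_jac_comp phi psi chi x : atlas phi -> atlas psi -> atlas chi ->
  dom phi x -> dom psi x -> dom chi x ->
  trans_jac phi chi x = trans_jac phi psi x *m trans_jac psi chi x.
Proof.
move=> aphi apsi achi px qx rx; apply/row_matrixP => i.
rewrite !rowE mulmxA.
apply: etrans (esym (derive_transition (delta_mx 0 i) aphi achi px rx)) _.
have nE : \forall y \near fwd phi x, transition phi chi y =
    (transition psi chi \o transition phi psi) y.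
  apply: (near_chartP (W := dom psi)) => //; first exact: dom_open.
  by move=> x' px' qx'; rewrite /= !transition_fwd.
apply: etrans (near_eq_derive _ nE) _.
have dT := transition_differentiable aphi apsi px qx.
have dT' := transition_differentiable apsi achi qx rx.
rewrite -(transition_fwd psi px) in dT'.
have [_ ->] := derivable_comp (delta_mx 0 i) dT dT'.
rewrite transition_fwd // (derive_transition (delta_mx 0 i) aphi apsi px qx).
exact: derive_transition.
Qed.

Lemma trans_jac_id phi x : atlas phi -> dom phi x -> trans_jac phi phi x = 1%:M.
Proof.
move=> aphi px; apply/row_matrixP => i.
rewrite !rowE mulmx1.
apply: etrans (esym (derive_transition (delta_mx 0 i) aphi aphi px px)) _.
have nE : \forall y \near fwd phi x, transition phi phi y = id y.
  apply: (near_chartP (W := dom phi)) => //; first exact: dom_open.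
  by move=> x' px' qx'; rewrite transition_fwd.
by rewrite (near_eq_derive _ nE) derive_id.
Qed.

Lemma trans_jacK phi psi x : atlas phi -> atlas psi -> dom phi x -> dom psi x ->
  trans_jac phi psi x *m trans_jac psi phi x = 1%:M.
Proof. by move=> *; rewrite -trans_jac_comp // trans_jac_id. Qed.

Lemma coord_form_fwd phi (a : M -> 'cV[R]_d) x : dom phi x ->
  coord_form phi a (fwd phi x) = trans_jac phi (chart_at x) x *m a x.
Proof. by move=> px; rewrite /coord_form fwdK. Qed.

Lemma pairing_coord_form phi (a : M -> 'cV[R]_d) x w : dom phi x ->
  pairing (coord_form phi a (fwd phi x)) w =
    pairing (a x) (w *m trans_jac phi (chart_at x) x).
Proof. by move=> px; rewrite coord_form_fwd // pairing_mulmx. Qed.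

Lemma coord_form_chart_at (a : M -> 'cV[R]_d) x :
  coord_form (chart_at x) a (fwd (chart_at x) x) = a x.
Proof.
have px := dom_chart_at x; have ax := chart_at_atlas x.
by rewrite coord_form_fwd // trans_jac_id // mul1mx.
Qed.

Lemma coord_vec_fwd phi (X : M -> 'rV[R]_d) x : dom phi x ->
  coord_vec phi X (fwd phi x) = X x *m trans_jac (chart_at x) phi x.
Proof. by move=> px; rewrite /coord_vec fwdK. Qed.

Lemma coord_vec_jac phi (X : M -> 'rV[R]_d) x : atlas phi -> dom phi x ->
  coord_vec phi X (fwd phi x) *m trans_jac phi (chart_at x) x = X x.
Proof.
move=> aphi px; have qx := dom_chart_at x; have ax := chart_at_atlas x.
by rewrite coord_vec_fwd // -mulmxA trans_jacK // mulmx1.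
Qed.

Lemma coord_vec_chart_at (X : M -> 'rV[R]_d) x :
  coord_vec (chart_at x) X (fwd (chart_at x) x) = X x.
Proof.
have px := dom_chart_at x; have ax := chart_at_atlas x.
by rewrite coord_vec_fwd // trans_jac_id // mulmx1.
Qed.

Lemma pairing_coord phi (a : M -> 'cV[R]_d) (X : M -> 'rV[R]_d) x :
  atlas phi -> dom phi x ->
  pairing (coord_form phi a (fwd phi x)) (coord_vec phi X (fwd phi x)) =
    pairing (a x) (X x).
Proof. by move=> *; rewrite coord_form_fwd // pairing_mulmx coord_vec_jac. Qed.

(** Supplies the pullback hypothesis of [coord_ext_deriv_pullback]. The components of [a] at [x] are
    stored in [chart_at x], hence the cocycle rule over three charts. *)
Lemma pairing_coord_form_transition phi psi (a : M -> 'cV[R]_d) x w :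
  atlas phi -> atlas psi -> dom phi x -> dom psi x ->
  pairing (coord_form phi a (fwd phi x)) w =
    pairing (coord_form psi a (fwd psi x)) ('D_w (transition phi psi) (fwd phi x)).
Proof.
move=> aphi apsi px qx; have rx := dom_chart_at x; have ax := chart_at_atlas x.
apply: etrans (pairing_coord_form a w px) _.
apply: etrans _ (esym (pairing_coord_form a _ qx)).
rewrite (derive_transition w aphi apsi px qx).
by rewrite (trans_jac_comp aphi apsi ax px qx rx) mulmxA.
Qed.

Lemma smooth_at phi W (E : normedModType R) (f : 'rV[R]_d -> E) x :
  open W -> smooth_on (fwd phi @` (dom phi `&` W)) f -> dom phi x -> W x ->
  \forall y \near fwd phi x, differentiable f y.
Proof.
move=> oW sf px Wx; apply: (near_chartP oW) => // x' px' Wx'.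
by apply: (smooth_on_differentiable sf); exists x'.
Qed.

(** Naturality under the transition from [phi] to the chart of [x]. As [chart_at] is an arbitrary
    choice at each point, an identity about [ext_deriv] must pass through this before it is
    differentiated. *)
Lemma ext_deriv_chart W (eta : M -> 'cV[R]_d) phi x u v :
  smooth_one_form W eta -> atlas phi -> dom phi x -> W x ->
  coord_ext_deriv (coord_form phi eta) (fwd phi x) u v =
    ext_deriv eta x (u *m trans_jac phi (chart_at x) x)
                    (v *m trans_jac phi (chart_at x) x).
Proof.
move=> seta aphi px Wx; have qx := dom_chart_at x; have ax := chart_at_atlas x.
rewrite -(derive_transition u aphi ax px qx) -(derive_transition v aphi ax px qx).
have := @coord_ext_deriv_pullback _ _ (transition phi (chart_at x))
  (coord_form phi eta) (coord_form (chart_at x) eta) (fwd phi x) u v.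
rewrite transition_fwd //; apply.
- apply: (near_chartP (W := dom (chart_at x))) => //; first exact: dom_open.
  by move=> *; exact: transition_differentiable.
- move=> w; apply: (smooth_on_derive_differentiable (transition_smooth aphi ax)).
  by exists x.
- by apply: (smooth_on_differentiable (seta _ aphi)); exists x.
- by apply: (smooth_on_differentiable (seta _ ax)); exists x.
- move=> w; apply: (near_chartP (W := dom (chart_at x))) => //; first exact: dom_open.
  by move=> x' px' qx'; rewrite transition_fwd //; exact: pairing_coord_form_transition.
Qed.

Lemma derive_coord_fun W (H : M -> R) phi x v :
  smooth_fun W H -> atlas phi -> dom phi x -> W x ->
  'D_v (coord_fun phi H) (fwd phi x) =
    pairing (dfun H x) (v *m trans_jac phi (chart_at x) x).
Proof.
move=> sH aphi px Wx; have qx := dom_chart_at x; have ax := chart_at_atlas x.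
set T := transition phi (chart_at x).
have nE : \forall y \near fwd phi x, coord_fun phi H y = (coord_fun (chart_at x) H \o T) y.
  apply: (near_chartP (W := dom (chart_at x))) => //; first exact: dom_open.
  by move=> x' px' qx'; rewrite /coord_fun /T /transition /= !fwdK.
rewrite (near_eq_derive _ nE).
have dT := transition_differentiable aphi ax px qx.
have dH : differentiable (coord_fun (chart_at x) H) (T (fwd phi x)).
  rewrite /T transition_fwd //.
  by apply: (smooth_on_differentiable (sH _ ax)); exists x.
have [_ ->] := derivable_comp v dT dH.
rewrite (derive_transition v aphi ax px qx).
move: dH; rewrite /T (transition_fwd _ px) => dH.
exact: derive_gradient.
Qed.

End Charts.

(** * Quadratic forms and their derivatives *)

Section QuadraticForms.
Variables (R : realType) (V : vectType R).

Lemma symmetric_part_bilinear (B : V -> V -> R) :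
  bilinear_form B -> bilinear_form (symmetric_part B).
Proof.
move=> [Bl Br]; split => w c u v; rewrite /symmetric_part.
  rewrite (Bl w c u v) (Br w c u v) /=; ring.
rewrite (Bl w c u v) (Br w c u v) /=; ring.
Qed.

Lemma is_derive_quadratic_form (S : V -> V -> R) (u v : V) :
  bilinear_form S -> (forall x y, S x y = S y x) ->
  is_derive (0 : R) (1 : R) (fun t : R => quadratic_form S (u + t *: v)) (S u v).
Proof.
move=> [Sl Sr] SC.
(* Q(u + t v) = Q(u) + t S(u, v) + t^2 Q(v), by the symmetry of S. *)
have -> : (fun t : R => quadratic_form S (u + t *: v)) =
    cst (quadratic_form S u) + S u v *: id + quadratic_form S v *: id ^+ 2.
  apply/funext => t; rewrite !fctE /quadratic_form (addrC u).
  have e w : S (t *: v + u) w = t * S v w + S u w by exact: Sr.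
  have e' w : S w (t *: v + u) = t * S w v + S w u by exact: Sl.
  by rewrite e !e' (SC v u) /GRing.scale /=; field.
have i0 := is_derive_id (0 : R) (1 : R).
have d1 := is_deriveD (is_derive_cst (quadratic_form S u) (0 : R) (1 : R)) (is_deriveZ (S u v) i0).
have d2 := is_deriveD d1 (is_deriveZ (quadratic_form S v) (is_deriveX 2 i0)).
apply: (is_derive_eq d2).
by rewrite add0r expr1 mulr0 scale0r scaler0 addr0 [LHS]mulr1.
Qed.

End QuadraticForms.

(** * The contact vector field in the chart at the equilibrium *)

Section ContactLinearization.
Variables (R : realType) (n : nat) (M : manifold R (2 * n).+1).
Variables (W : set M) (eta : M -> 'cV[R]_(2 * n).+1)
  (Rb X : M -> 'rV[R]_(2 * n).+1) (H : M -> R) (x0 : M).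
Hypotheses (oW : open W) (Wx0 : W x0).
Hypotheses (eta_smooth : smooth_one_form W eta) (H_smooth : smooth_fun W H).

Let phi := chart_at x0.
Let y0 := fwd phi x0.
Let a := coord_form phi eta.
Let h := coord_fun phi H.
(** The components of dH in the single chart [phi], whereas those of [dfun H] refer to a chart
    varying with the point. *)
Let grad (y : 'rV[R]_(2 * n).+1) : 'cV[R]_(2 * n).+1 := \col_i 'D_(delta_mx 0 i) h y.
Let aphi : atlas phi := chart_at_atlas x0.
Let px0 : dom phi x0 := dom_chart_at x0.
Let y0_img : (fwd phi @` (dom phi `&` W)) y0.
Proof. by exists x0. Qed.
Let a_y0 : a y0 = eta x0 := coord_form_chart_at eta x0.

Let a_diff : \forall y \near y0, differentiable a y :=
  smooth_at oW (eta_smooth aphi) px0 Wx0.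
Let Da_diff w : differentiable ('D_w a) y0 :=
  smooth_on_derive_differentiable (eta_smooth aphi) w y0_img.
Let h_diff : \forall y \near y0, differentiable h y :=
  smooth_at oW (H_smooth aphi) px0 Wx0.
Let Dh_diff w : differentiable ('D_w h) y0 :=
  smooth_on_derive_differentiable (H_smooth aphi) w y0_img.

Let gradE y w : differentiable h y -> pairing (grad y) w = 'D_w h y.
Proof. by move=> hy; exact: esym (derive_gradient w hy). Qed.

Let grad_derivable u : derivable grad y0 u.
Proof.
apply/derivable_mxP => i j; under eq_fun do rewrite mxE.
exact: diff_derivable.
Qed.

Lemma ext_deriv_bilinear : bilinear_form (ext_deriv eta x0).
Proof. exact: (coord_ext_deriv_bilinear (nbhs_singleton a_diff)). Qed.

(** The coordinate form of dH + tau eta equals [grad + tau *: a] on a whole neighbourhood of [y0],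
    so both sides can be differentiated there. *)
Lemma amended_hessianE tau u v :
  amended_hessian eta H tau x0 u v = 'D_u ('D_v h) y0 + tau * deriv_form eta x0 u v.
Proof.
pose b := coord_form phi (fun x : M => dfun H x + tau *: eta x).
have bE : \forall y \near y0, (grad + tau *: a) y = b y.
  apply: (near_chartP oW px0 Wx0) => x px Wx.
  have hx : differentiable h (fwd phi x).
    by apply: (smooth_on_differentiable (H_smooth aphi)); exists x.
  rewrite /b (coord_form_fwd _ px) mulmxDr -scalemxAr.
  rewrite -(coord_form_fwd eta px) /= !fctE; congr (_ + _).
  apply/matrixP => i j; rewrite ord1.
  have e (c : 'cV[R]_(2 * n).+1) : c i 0 = pairing c (delta_mx 0 i).
    by rewrite /pairing -rowE mxE.
  apply: etrans (e _) _; apply: etrans _ (esym (e _)).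
  apply: etrans (gradE _ hx) _; apply: etrans (derive_coord_fun _ H_smooth aphi px Wx) _.
  by rewrite pairing_mulmx.
rewrite /amended_hessian /deriv_form -/phi -/y0 -/b -/a.
rewrite -(near_eq_derive _ bE).
have [_ ->] := is_deriveD (derivableP (@grad_derivable u))
  (is_deriveZ tau (derivableP (diff_derivable (v := u) (nbhs_singleton a_diff)))).
rewrite pairingDl pairingZl; congr (_ + _).
have [_ <-] := derive_pairing v (@grad_derivable u).
by apply: near_eq_derive; apply: filterS h_diff => y hy; exact: gradE.
Qed.

Lemma amended_hessian_bilinear tau : bilinear_form (amended_hessian eta H tau x0).
Proof.
split => [u|v] c w z; first exact: pairing_linear.
have hl := derive_linear_dir c w z (Dh_diff v).
have al := derive_linear_dir c w z (nbhs_singleton a_diff).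
have al' : deriv_form eta x0 (c *: w + z) v =
    c * deriv_form eta x0 w v + deriv_form eta x0 z v.
  by rewrite /deriv_form -/phi -/y0 -/a al pairingDl pairingZl.
have E u := amended_hessianE tau u v.
apply: etrans (E _) _; apply: etrans (congr2 (fun r s => r + tau * s) hl al') _.
apply: etrans _ (esym (congr2 (fun r s => c * r + s) (E w) (E z))).
have alg (p q r s : R) : c * p + q + tau * (c * r + s) = c * (p + tau * r) + (q + tau * s).
  by ring.
exact: alg.
Qed.

(** The second derivatives of [h] cancel, and only the derivative of eta survives. *)
Lemma amended_hessian_antisym tau u v :
  amended_hessian eta H tau x0 u v - amended_hessian eta H tau x0 v u =
    tau * ext_deriv eta x0 u v.
Proof.
apply: etrans (congr2 (fun r s => r - s) (amended_hessianE tau u v) (amended_hessianE tau v u)) _.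
move: ('D_u ('D_v h) y0) ('D_v ('D_u h) y0)
  (derive_derive_comm_real h_diff (Dh_diff u) (Dh_diff v)) => p _ <-.
have alg (r s : R) : p + tau * r - (p + tau * s) = tau * (r - s) by ring.
exact: alg.
Qed.

Hypothesis Rb_reeb : reeb_field W eta Rb.
Hypothesis X_contact : contact_vector_field W eta Rb H X.
Hypothesis X0 : X x0 = 0.

Let Y := coord_vec phi X.
Let Z := coord_vec phi Rb.
(** The function R(H) in the coordinates of [phi]. *)
Let rho y := pairing (grad y) (Z y).
Let Y_diff : differentiable Y y0 :=
  smooth_on_differentiable (X_contact.1 _ aphi) y0_img.
Let Z_diff : differentiable Z y0 :=
  smooth_on_differentiable (Rb_reeb.1 _ aphi) y0_img.
Let Y0 : Y y0 = 0.
Proof. by rewrite /Y /y0 coord_vec_chart_at. Qed.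

Let rhoE x : dom phi x -> W x -> rho (fwd phi x) = pairing (dfun H x) (Rb x).
Proof.
move=> px Wx.
have hx : differentiable h (fwd phi x).
  by apply: (smooth_on_differentiable (H_smooth aphi)); exists x.
apply: etrans (gradE _ hx) _; apply: etrans (derive_coord_fun _ H_smooth aphi px Wx) _.
by rewrite coord_vec_jac.
Qed.

Let tau := principal_coefficient Rb H x0.

Lemma linear_partE u : linear_part X x0 u = 'D_u Y y0.
Proof. by rewrite /linear_part lfunE /=; exact: esym (deriveE _ Y_diff). Qed.

(** At a zero of [X] the contraction with d eta vanishes, which leaves dH = R(H) eta. *)
Lemma dfun_equilibrium v : pairing (dfun H x0) v = - tau * pairing (eta x0) v.
Proof.
have [_ /(_ x0 Wx0) [_ /(_ v)]] := X_contact.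
have [_ Er] := ext_deriv_bilinear.
have e0 : ext_deriv eta x0 0 v = 0.
  by have := Er v (-1) 0 0; rewrite /= scaler0 addr0 mulN1r addNr.
rewrite X0 e0 pairingDl -scaleNr pairingZl => /esym/eqP; rewrite addr_eq0 => /eqP ->.
by rewrite /tau /principal_coefficient opprK mulNr opprK.
Qed.

Lemma linear_part_pairing u :
  pairing (eta x0) (linear_part X x0 u) = tau * pairing (eta x0) u.
Proof.
rewrite linear_partE -a_y0.
apply: etrans (linearized_pairing (h := h) a_diff Y_diff Y0 _ _ _) _.
- apply: (near_chartP oW px0 Wx0) => x px Wx.
  apply: etrans (pairing_coord eta X aphi px) _.
  by have [-> _] := X_contact.2 x Wx; rewrite /h /coord_fun /= fwdK.
- exact: nbhs_singleton h_diff.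
have -> : 'D_u h y0 = pairing (dfun H x0) u.
  apply: etrans (derive_coord_fun _ H_smooth aphi px0 Wx0) _.
  by rewrite trans_jac_id // mulmx1.
by rewrite dfun_equilibrium mulNr opprK a_y0.
Qed.

Lemma ext_deriv_linear_part u v : pairing (eta x0) v = 0 ->
  ext_deriv eta x0 (linear_part X x0 u) v = amended_hessian eta H tau x0 u v.
Proof.
move=> v0; rewrite linear_partE amended_hessianE.
have rhoD : derivable rho y0 u.
  by have [] := is_derive_pairing (@grad_derivable u) (diff_derivable (v := u) Z_diff).
apply: etrans (linearized_ext_deriv a_diff Da_diff Y_diff Y0 _ (Dh_diff v) rhoD _) _.
- apply: (near_chartP oW px0 Wx0) => x px Wx.
  apply: etrans (ext_deriv_chart _ _ eta_smooth aphi px Wx) _.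
  rewrite (coord_vec_jac X aphi px); have [_ ->] := X_contact.2 x Wx.
  rewrite rhoE // pairingDl -scaleNr pairingZl mulNr; congr (_ - _ * _).
    exact: esym (derive_coord_fun _ H_smooth aphi px Wx).
  exact: esym (pairing_coord_form _ _ px).
- by rewrite a_y0.
(* Since R(H) at [x0] is - tau, the subtracted term is the summand tau D_u eta (v) of the amended
   Hessian. *)
by rewrite rhoE // /tau /principal_coefficient mulNr.
Qed.

End ContactLinearization.

(** * Invariance of the contact hyperplane and the Hamiltonian property *)

Theorem theorem2p4 (R : realType) (n : nat) (M : manifold R (2 * n).+1)
    (xi : M -> {vspace 'rV[R]_(2 * n).+1})
    (W : set M) (eta : M -> 'cV[R]_(2 * n).+1)
    (Rb : M -> 'rV[R]_(2 * n).+1)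
    (H : M -> R) (X : M -> 'rV[R]_(2 * n).+1) (x0 : M) (tau : R)
    (hxi : contact_structure xi)
    (heta : defining_form xi W eta)
    (hRb : reeb_field W eta Rb)
    (hH : smooth_fun W H)
    (hX : contact_vector_field W eta Rb H X)
    (hx0 : W x0) (hequilibrium : X x0 = 0)
    (htau : tau = principal_coefficient Rb H x0) :
  (linear_part X x0 @: xi x0 <= xi x0)%VS /\
  linear_hamiltonian
    (restrict_bilinear (U := xi x0) (ext_deriv eta x0))
    (restriction (linear_part X x0) (xi x0) - (2^-1 * tau) *: \1%VF)
    (symmetric_part
       (restrict_bilinear (U := xi x0) (amended_hessian eta H tau x0))).
Proof.
have [oW eta_smooth kerE] := heta; have {}kerE := kerE x0 hx0.
have [El Er] := ext_deriv_bilinear oW hx0 eta_smooth.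
have xi_inv u : u \in xi x0 -> linear_part X x0 u \in xi x0.
  move=> /kerE u0; apply/kerE.
  by rewrite (linear_part_pairing oW hx0 eta_smooth hH hX hequilibrium) u0 mulr0.
(* The projection inside [restriction] acts as the identity because the image stays in [xi x0]. The
   right side has the shape [c *: x + y] to which bilinearity applies. *)
have restrE (u : subvs_of (xi x0)) :
    vsval ((restriction (linear_part X x0) (xi x0) - (2^-1 * tau) *: \1%VF) u) =
      - (2^-1 * tau) *: vsval u + linear_part X x0 (vsval u).
  rewrite add_lfunE opp_lfunE scale_lfunE id_lfunE /restriction !comp_lfunE !lfunE /=.
  have := xi_inv _ (subvsP u); rewrite /linear_part lfunE /= => Lu.
  by rewrite (vsprojK Lu) addrC scaleNr.
have restr_bilinear (B : 'rV[R]_(2 * n).+1 -> 'rV[R]_(2 * n).+1 -> R) :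
    bilinear_form B -> bilinear_form (restrict_bilinear (U := xi x0) B).
  by move=> [Bl Br]; split => [u|u] c v w; rewrite /restrict_bilinear linearP;
    [exact: Bl|exact: Br].
have amended_bil := amended_hessian_bilinear oW hx0 eta_smooth hH tau.
have Sbil := symmetric_part_bilinear (restr_bilinear _ amended_bil).
have SC (B : subvs_of (xi x0) -> subvs_of (xi x0) -> R) u v :
    symmetric_part B u v = symmetric_part B v u.
  by rewrite /symmetric_part addrC.
have altE u : ext_deriv eta x0 u u = 0 by rewrite /ext_deriv subrr.
have wE u v : restrict_bilinear (U := xi x0) (ext_deriv eta x0)
    ((restriction (linear_part X x0) (xi x0) - (2^-1 * tau) *: \1%VF) u) v =
  symmetric_part (restrict_bilinear (U := xi x0) (amended_hessian eta H tau x0)) u v.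
  rewrite /restrict_bilinear restrE (Er (vsval v) _ _ _) /=.
  have /kerE v0 := subvsP v.
  rewrite (ext_deriv_linear_part oW hx0 eta_smooth hH hRb hX hequilibrium) // -htau.
  (* With p = Hess'(u, v), q = Hess'(v, u) and e = d eta (u, v), the relation p - q = tau e turns p
     - tau e / 2 into (p + q) / 2. *)
  have := amended_hessian_antisym oW hx0 eta_smooth hH tau (vsval u) (vsval v).
  rewrite /symmetric_part; set p := amended_hessian _ _ _ _ _ _.
  set q := amended_hessian _ _ _ _ _ _; set e := ext_deriv _ _ _ _; lra.
split.
  by apply/subvP => _ /memv_imgP [u uxi ->]; exact: xi_inv.
split; [split| exact: Sbil | exact: SC |]; first exact: (restr_bilinear _ (conj El Er)).
- by move=> u; exact: altE.
- move: {wE} hxi.2 => /(_ W eta heta x0 hx0) [v vn0] u u0; apply: val_inj => /=.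
  have [Rb1 Rb0] := hRb.2 x0 hx0.
  apply: (contact_form_radical _ (conj El Er) altE _ _ vn0).
  + exact: pairing_linear.
  + by apply/kerE; exact: subvsP.
  + move=> x.
    (* Split [x] into its Reeb component and a remainder, which lies in [xi x0] because eta(R) =
       1. *)
    have xE : x = pairing (eta x0) x *: Rb x0 + (x - pairing (eta x0) x *: Rb x0).
      by rewrite addrC subrK.
    have zxi : x - pairing (eta x0) x *: Rb x0 \in xi x0.
      apply/kerE; rewrite -scaleNr addrC pairing_linear Rb1; ring.
    have uz := u0 (Subvs zxi); rewrite /restrict_bilinear /= in uz.
    rewrite xE (El (vsval u) _ _ _) /= uz.
    have -> : ext_deriv eta x0 (vsval u) (Rb x0) = 0.
      by rewrite /ext_deriv -opprB [X in - X]Rb0 oppr0.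
    by rewrite mulr0 addr0.
- move=> u v; split; last exact: wE.
  by rewrite wE; exact: is_derive_quadratic_form Sbil (SC _).
Qed.
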